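(* Let $n, n_s \ge 1$, let $\mathbf{M} \in \mathbb{R}^{n\times n}$ be symmetric positive definite, and let $\mathscr{H}$ be $\mathbb{R}^n$ endowed with the inner product $\langle u, v\rangle_{\mathscr{H}} = u^{\mathsf T}\mathbf{M} v$. Let $\mathbf{F}:\mathscr{H}\to\mathbb{R}^{n_s}$ be a linear transformation (with $\mathbb{R}^{n_s}$ carrying the Euclidean inner product), with adjoint $\mathbf{F}^* = \mathbf{M}^{-1}\mathbf{F}^{\mathsf T}$, let $\sigma_1,\dots,\sigma_{n_s} > 0$, and let $\mathbf{\Gamma}_{\mathrm{pr}}$ be a strictly positive selfadjoint operator on $\mathscr{H}$. Let $\{e_i\}_{i=1}^{n_s}$ be the standard basis of $\mathbb{R}^{n_s}$ and set $$f_i = \sigma_i^{-1}\mathbf{F}^* e_i, \qquad \tilde f_i = \mathbf{\Gamma}_{\mathrm{pr}}^{1/2} f_i, \qquad i \in V := \{1,\dots,n_s\}.$$ Assume $f_i \neq 0$ for all $i \in V$. For $S\subseteq V$ define $$\tilde{\mathbf{H}}(S) = \sum_{i\in S} \tilde f_i\otimes \tilde f_i, \qquad \Phi_{\mathrm{eig}}(S) = \log\det\big(\mathbf{I} + \tilde{\mathbf{H}}(S)\big),$$ where $\tilde{\mathbf{H}}(\emptyset) = 0$. Then the following hold: (i) $\Phi_{\mathrm{eig}}(\emptyset) = 0$; (ii) $\Phi_{\mathrm{eig}}$ is strictly monotone, i.e. $\Phi_{\mathrm{eig}}(A) < \Phi_{\mathrm{eig}}(B)$ whenever $A \subsetneq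 B\subseteq V$; (iii) $\Phi_{\mathrm{eig}}$ is submodular, i.e. for every $A\subseteq B\subseteq V$ and $v\in V\setminus B$, $$\Phi_{\mathrm{eig}}(A\cup\{v\}) - \Phi_{\mathrm{eig}}(A) \ \ge\ \Phi_{\mathrm{eig}}(B\cup\{v\}) - \Phi_{\mathrm{eig}}(B).$$
   Context: For $u, v\in\mathscr{H}$, the tensor product $u\otimes v$ is the rank-one linear operator on $\mathscr{H}$ given by $(u\otimes v)x = \langle v, x\rangle_{\mathscr{H}}\, u$; in matrix form $u\otimes v = u v^{\mathsf T}\mathbf{M}$. The operator $\mathbf{\Gamma}_{\mathrm{pr}}^{1/2}$ is the positive selfadjoint square root of $\mathbf{\Gamma}_{\mathrm{pr}}$ on $\mathscr{H}$, where selfadjointness and strict positivity are with respect to $\langle\cdot,\cdot\rangle_{\mathscr{H}}$. $\mathbf{I}$ is the identity on $\mathscr{H}$, and $\log$ is the natural logarithm. Background: this is the setting of a linear Gaussian Bayesian inverse problem $y = \mathbf{F} m + \eta$ with prior $\mathcal{N}(m_{\mathrm{pr}}, \mathbf{\Gamma}_{\mathrm{pr}})$ on $m$, independent noise $\eta\sim\mathcal{N}(0, \mathrm{diag}(\sigma_1^2,\dots,\sigma_{n_s}^2))$, and $V$ indexing candidate sensor locations (rows of $\mathbf{F}$). $\Phi_{\mathrm{eig}}(S)$ is twice the expected information gain (the expected Kullback--Leibler divergence from posterior to prior) when only the measurements indexed by $S$ are used. *)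

(* Defs.v *)
From mathcomp Require Import all_boot all_order all_algebra.
From mathcomp Require Import all_classical all_reals all_analysis.
Set Implicit Arguments.
Unset Strict Implicit.
Unset Printing Implicit Defensive.
Import Order.TTheory GRing.Theory Num.Theory.
Local Open Scope classical_set_scope.
Local Open Scope ring_scope.

(* Elements of H = R^n are column vectors, the inner product of H is carried by
   the matrix M, and operators are matrices acting on the left. *)

Definition innerM (R : realType) (n : nat) (M : 'M[R]_n) (u v : 'cV[R]_n) : R :=
  (u^T *m M *m v) 0 0.

Definition spd_mx (R : realType) (n : nat) (M : 'M[R]_n) : Prop :=
  M^T = M /\ forall u : 'cV[R]_n, u != 0 -> 0 < (u^T *m M *m u) 0 0.

Definition selfadjoint (R : realType) (n : nat) (M A : 'M[R]_n) : Prop :=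
  forall u v : 'cV[R]_n, innerM M (A *m u) v = innerM M u (A *m v).

Definition positive_op (R : realType) (n : nat) (M A : 'M[R]_n) : Prop :=
  forall u : 'cV[R]_n, 0 <= innerM M u (A *m u).

Definition strictly_positive_op (R : realType) (n : nat) (M A : 'M[R]_n) :
    Prop :=
  forall u : 'cV[R]_n, u != 0 -> 0 < innerM M u (A *m u).

(* When M is symmetric positive definite and A is a positive selfadjoint
   operator on H, there is exactly one B satisfying these conditions; the
   default value 0 is returned only when there is none. *)
Definition sqrt_op (R : realType) (n : nat) (M A : 'M[R]_n) : 'M[R]_n :=
  xget 0 [set B : 'M[R]_n |
    [/\ selfadjoint M B, positive_op M B & B *m B = A]].

(* Adjoint of F : H -> R^ns, where R^ns is Euclidean; see adjointP. *)
Definition adjoint (R : realType) (n ns : nat) (M : 'M[R]_n)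
    (F : 'M[R]_(ns, n)) : 'M[R]_(n, ns) :=
  invmx M *m F^T.

(* The operator x |-> <v, x>_H u; see tensorP. *)
Definition tensor (R : realType) (n : nat) (M : 'M[R]_n) (u v : 'cV[R]_n) :
    'M[R]_n :=
  u *m v^T *m M.

Definition fvec (R : realType) (n ns : nat) (M : 'M[R]_n) (F : 'M[R]_(ns, n))
    (sigma : 'I_ns -> R) (i : 'I_ns) : 'cV[R]_n :=
  (sigma i)^-1 *: (adjoint M F *m delta_mx i 0).

Definition ftilde (R : realType) (n ns : nat) (M : 'M[R]_n)
    (F : 'M[R]_(ns, n)) (sigma : 'I_ns -> R) (Gpr : 'M[R]_n) (i : 'I_ns) :
    'cV[R]_n :=
  sqrt_op M Gpr *m fvec M F sigma i.

Definition Htilde (R : realType) (n ns : nat) (M : 'M[R]_n)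
    (F : 'M[R]_(ns, n)) (sigma : 'I_ns -> R) (Gpr : 'M[R]_n)
    (S : {set 'I_ns}) : 'M[R]_n :=
  \sum_(i in S) tensor M (ftilde M F sigma Gpr i) (ftilde M F sigma Gpr i).

Definition Phi_eig (R : realType) (n ns : nat) (M : 'M[R]_n)
    (F : 'M[R]_(ns, n)) (sigma : 'I_ns -> R) (Gpr : 'M[R]_n)
    (S : {set 'I_ns}) : R :=
  ln (\det (1%:M + Htilde M F sigma Gpr S)).

Lemma tensorP (R : realType) (n : nat) (M : 'M[R]_n) (u v x : 'cV[R]_n) :
  tensor M u v *m x = innerM M v x *: u.
Proof.
by rewrite /tensor /innerM -!mulmxA -mul_mx_scalar -mx11_scalar.
Qed.

Lemma spd_unitmx (R : realType) (n : nat) (M : 'M[R]_n) :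
  spd_mx M -> M \in unitmx.
Proof.
move=> [Msym Mpos]; rewrite -row_free_unit -kermx_eq0.
apply/rowV0P => w /sub_kermxP wM0; apply/eqP/negPn/negP => wN0.
have := Mpos w^T; rewrite trmx_eq0 wN0 trmxK wM0 mul0mx mxE ltxx.
by move=> /(_ isT).
Qed.

Lemma adjointP (R : realType) (n ns : nat) (M : 'M[R]_n) (F : 'M[R]_(ns, n))
    (x : 'cV[R]_n) (y : 'cV[R]_ns) :
  spd_mx M -> ((F *m x)^T *m y) 0 0 = innerM M x (adjoint M F *m y).
Proof.
move=> Mspd; rewrite /innerM /adjoint trmx_mul !mulmxA.
by rewrite mulmxK ?spd_unitmx.
Qed.

(* Main.v *)
Require Import Defs.
From mathcomp Require Import all_boot all_order all_algebra.
From mathcomp Require Import all_classical all_reals all_analysis.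
From mathcomp Require Import complex lra.
Import Order.TTheory GRing.Theory Num.Theory.
Local Open Scope ring_scope.
Set Implicit Arguments.
Unset Strict Implicit.
Unset Printing Implicit Defensive.

(** Write K(S) = I + H~(S).  It is selfadjoint for the inner product of H,
and <u, K(S) u> = <u, u> + sum_(i in S) <f~_i, u>^2, so K(S) >= I and K grows
with S.  Adding a sensor v to S is a rank-one update of K(S), and the matrix
determinant lemma gives

  det K(v |: S) = det K(S) * (1 + gain S v),
  gain S v = <f~_v, K(S)^-1 f~_v>,

so the increment of Phi_eig is ln (1 + gain S v) ([ln_det_info_opU1]).  Both
claims about Phi_eig are claims about the gain.

- The gain is positive when f~_v != 0, because K(S)^-1 is positive definite
  ([info_gain_gt0]); this yields strict monotonicity.
- The gain decreases as S grows ([info_gain_anti]), because K |-> K^-1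
  reverses the order of positive definite operators; this yields
  submodularity.

It remains to see that f~_v = Gpr^(1/2) f_v is nonzero when f_v is.  As
[sqrt_op] is a choice among the positive selfadjoint square roots, this is the
existence of one ([sqrt_op_exists]).  A selfadjoint operator A has only real
eigenvalues, so its characteristic polynomial splits over R; the product of
the X - a over the distinct eigenvalues a kills A, since its value at A is
selfadjoint and nilpotent.  Hence a polynomial in A is determined by its values
at the eigenvalues, and if q interpolates the fourth roots of the eigenvalues
then q(A)^4 = A, so that q(A)^2 is a square root of A; it is positive as the
square of a selfadjoint operator. *)

(** * The inner product of H *)

Section InnerProduct.
Variables (R : realType) (n : nat) (M : 'M[R]_n).
Implicit Types (A B : 'M[R]_n) (u v w : 'cV[R]_n).

Lemma innerMDl u v w : innerM M (u + v) w = innerM M u w + innerM M v w.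
Proof. by rewrite /innerM linearD /= !mulmxDl mxE. Qed.

Lemma innerMDr u v w : innerM M u (v + w) = innerM M u v + innerM M u w.
Proof. by rewrite /innerM mulmxDr mxE. Qed.

Lemma innerMZl a u v : innerM M (a *: u) v = a * innerM M u v.
Proof. by rewrite /innerM linearZ /= -!scalemxAl mxE. Qed.

Lemma innerMZr a u v : innerM M u (a *: v) = a * innerM M u v.
Proof. by rewrite /innerM -scalemxAr mxE. Qed.

Lemma innerMBl u v w : innerM M (u - v) w = innerM M u w - innerM M v w.
Proof. by rewrite -scaleN1r innerMDl innerMZl mulN1r. Qed.

Lemma innerMBr u v w : innerM M u (v - w) = innerM M u v - innerM M u w.
Proof. by rewrite -scaleN1r innerMDr innerMZr mulN1r. Qed.

Lemma innerM0r u : innerM M u 0 = 0.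
Proof. by rewrite /innerM mulmx0 mxE. Qed.

Lemma innerM_sumr (I : finType) (P : pred I) u (f : I -> 'cV[R]_n) :
  innerM M u (\sum_(i | P i) f i) = \sum_(i | P i) innerM M u (f i).
Proof. by rewrite /innerM mulmx_sumr summxE. Qed.

Hypothesis hM : spd_mx M.

Lemma innerMC u v : innerM M u v = innerM M v u.
Proof.
rewrite /innerM -[in LHS](trmxK (_ *m v)) mxE !trmx_mul trmxK.
by rewrite (proj1 hM) mulmxA.
Qed.

Lemma innerM_gt0 u : u != 0 -> 0 < innerM M u u.
Proof. exact: (proj2 hM). Qed.

Lemma innerM_ge0 u : 0 <= innerM M u u.
Proof.
by have [->|/innerM_gt0/ltW//] := eqVneq u 0; rewrite innerM0r.
Qed.

Lemma innerM_eq0 u : innerM M u u = 0 -> u = 0.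
Proof.
by move=> u0; apply/eqP/negPn/negP => /innerM_gt0; rewrite u0 ltxx.
Qed.

End InnerProduct.

(** * Existence of the square root of a strictly positive operator *)

Lemma mulmx_col_inj (R : pzSemiRingType) m n (A B : 'M[R]_(m, n)) :
  (forall u : 'cV_n, A *m u = B *m u) -> A = B.
Proof.
move=> AB; apply/matrixP => i j.
by have /colP/(_ i) := AB (delta_mx j 0); rewrite -!colE !mxE.
Qed.

Lemma char_poly_tr (R : comNzRingType) n (A : 'M[R]_n) :
  char_poly A^T = char_poly A.
Proof.
rewrite /char_poly -det_tr /char_poly_mx linearB /= tr_scalar_mx.
by rewrite map_trmx trmxK.
Qed.

Lemma poly_interpolation (F : fieldType) (s : seq F) (f : F -> F) :
  uniq s -> exists q : {poly F}, {in s, forall x, q.[x] = f x}.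
Proof.
elim: s => [|a s IHs] /=; first by exists 0.
case/andP=> aNs /IHs[q qs].
pose p := \prod_(b <- s) ('X - b%:P).
have pa0 : p.[a] != 0 by rewrite -rootE root_prod_XsubC.
exists (q + ((f a - q.[a]) / p.[a]) *: p) => x; rewrite inE !hornerE.
case/predU1P => [->|xs]; first by rewrite divfK // addrC subrK.
have /rootP -> : root p x by rewrite root_prod_XsubC.
by rewrite mulr0 addr0 qs.
Qed.

Section SelfadjointSquareRoot.
Variables (R : realType) (n : nat) (M : 'M[R]_n.+1).
Hypothesis hM : spd_mx M.
Implicit Types (A B : 'M[R]_n.+1) (u v w : 'cV[R]_n.+1).

Lemma selfadjoint_horner_mx A p :
  selfadjoint M A -> selfadjoint M (horner_mx A p).
Proof.
move=> sA; elim/poly_ind: p => [|p c IHp] u v.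
  by rewrite rmorph0 !mul0mx innerMC ?innerM0r.
rewrite rmorphD rmorphM /= horner_mx_X horner_mx_C !mulmxDl !mul_scalar_mx.
rewrite innerMDl innerMDr innerMZl innerMZr -mulmxE -mulmxA IHp sA.
congr (innerM _ _ _ + _); rewrite !mulmxA; congr (_ *m _).
by apply: comm_mx_sym; apply: comm_horner_mx; exact: comm_mx_refl.
Qed.

(** If A^(k+2) = 0, then |A^(k+1) u|^2 = <A^k u, A^(k+2) u> = 0, so the exponent
can be lowered down to 1. *)
Lemma selfadjoint_expr_eq0 A k : selfadjoint M A -> A ^+ k.+1 = 0 -> A = 0.
Proof.
move=> sA; elim: k => [|k IHk]; first by rewrite expr1.
move=> Ak0; apply: IHk; apply: mulmx_col_inj => u.
rewrite mul0mx exprS -mulmxE -mulmxA; apply: (innerM_eq0 hM).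
rewrite sA !mulmxA -[A *m A *m _]mulmxA !mulmxE -!exprS Ak0.
by rewrite mul0mx innerM0r.
Qed.

Lemma strictly_positive_root_gt0 A a :
  strictly_positive_op M A -> root (char_poly A) a -> 0 < a.
Proof.
move=> pA; rewrite -char_poly_tr -eigenvalue_root_char.
move=> /eigenvalueP[v /(congr1 trmx)].
rewrite trmx_mul trmxK linearZ /= => Av; rewrite -trmx_eq0 => v0.
by have := pA _ v0; rewrite Av innerMZr pmulr_lgt0 // innerM_gt0.
Qed.

(** Over the complex numbers the characteristic polynomial splits; if a + ib is
one of its roots then (A - a)^2 + b^2 is singular, and a nonzero real vector u
in its kernel satisfies |(A - a) u|^2 + b^2 |u|^2 = 0, which forces b = 0. *)
Lemma selfadjoint_char_poly_split A : selfadjoint M A ->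
  exists s : seq R, char_poly A = \prod_(a <- s) ('X - a%:P).
Proof.
move=> sA.
have real_root (z : R[i]) :
    root (map_poly (real_complex R) (char_poly A)) z -> z = (complex.Re z)%:C%C.
  rewrite map_char_poly -eigenvalue_root_char => /eigenvalueP[w wA w0].
  case: z wA => a b wA; apply/eqP; rewrite eq_complex /= eqxx /=.
  (* The real quadratic polynomial with roots a + ib and a - ib. *)
  pose q : {poly R} := ('X - a%:P) ^+ 2 + (b ^+ 2)%:P.
  have : root (map_poly (real_complex R) q) (a +i* b)%C.
    rewrite rmorphD /= rmorphXn /= rmorphB /= map_polyX !map_polyC /=.
    rewrite rootE !hornerE; apply/eqP; rewrite expr2.
    apply/eqP; rewrite eq_complex /=.
    rewrite !(subrr, subr0, mul0r, mulr0, sub0r, addr0) expr2 addNr.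
    by rewrite eqxx.
  move=> /factor_theorem[r qr].
  (* If q(A) were invertible, then so would be its factor A - (a + ib), which
     kills w. *)
  have qA0 : horner_mx A q \notin unitmx.
    apply/negP; rewrite -(map_unitmx (real_complex R)) map_horner_mx qr => qu.
    move: w0; rewrite -[w](mulmxK qu) mulrC rmorphM /= -mulmxE mulmxA.
    rewrite rmorphB /= horner_mx_X horner_mx_C mulmxBr wA mul_mx_scalar subrr.
    by rewrite !mul0mx eqxx.
  have /det0P[v v0] : \det (horner_mx A q)^T == 0.
    by rewrite det_tr -[_ == _]negbK -unitfE -unitmxE.
  move=> /(congr1 trmx); rewrite trmx_mul trmxK trmx0.
  move: v0; rewrite -trmx_eq0; move: v^T => u u0 qu0.
  have sB := selfadjoint_horner_mx ('X - a%:P) sA.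
  have : innerM M u (horner_mx A q *m u) = 0 by rewrite qu0 innerM0r.
  rewrite rmorphD rmorphXn /= horner_mx_C expr2 mulmxDl mul_scalar_mx.
  rewrite innerMDr innerMZr -mulmxE -mulmxA -sB => /eqP.
  have bu_ge0 : 0 <= b ^+ 2 * innerM M u u.
    by rewrite mulr_ge0 ?sqr_ge0 ?innerM_ge0.
  rewrite paddr_eq0 ?innerM_ge0 // -?expr2.
  by rewrite mulf_eq0 sqrf_eq0 (gt_eqF (innerM_gt0 hM u0)) orbF => /andP[].
pose chC := map_poly (real_complex R) (char_poly A).
have [rs /esym] := closed_field_poly_normal chC.
rewrite lead_coef_map (monicP (char_poly_monic A)) rmorph1 scale1r => rsP.
exists [seq complex.Re z | z <- rs].
apply: (map_poly_inj (real_complex R)).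
rewrite -/chC -rsP rmorph_prod /= big_map; apply: eq_big_seq => z zs.
rewrite rmorphB /= map_polyX map_polyC /= -real_root //.
by rewrite -/chC -rsP root_prod_XsubC.
Qed.

(** This is diagonalizability of A: by Cayley-Hamilton a power of the left-hand
side vanishes, and selfadjoint operators have no nontrivial nilpotents. *)
Lemma selfadjoint_annihilator A (s : seq R) : selfadjoint M A ->
  char_poly A = \prod_(a <- s) ('X - a%:P) ->
  horner_mx A (\prod_(a <- undup s) ('X - a%:P)) = 0.
Proof.
move=> sA chA; apply: (@selfadjoint_expr_eq0 _ (size s)).
  exact: selfadjoint_horner_mx.
have dvd_exp t : {subset t <= s} -> \prod_(a <- t) ('X - a%:P) %|
    (\prod_(a <- undup s) ('X - a%:P)) ^+ size t.
  elim: t => [|x t IHt] ts /=; first by rewrite big_nil dvd1p.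
  rewrite big_cons exprS dvdp_mul ?IHt // => [|y yt].
    by rewrite dvdp_XsubCl root_prod_XsubC mem_undup ts ?mem_head.
  by rewrite ts // inE yt orbT.
have dv : char_poly A %| (\prod_(a <- undup s) ('X - a%:P)) ^+ (size s).+1.
  by rewrite chA exprS dvdp_mull // dvd_exp.
rewrite -rmorphXn /=; have /dvdpP[q ->] := dv.
by rewrite rmorphM /= Cayley_Hamilton mulr0.
Qed.

(** The witness is q(A)^2, where q interpolates the fourth root (not the square
root) at the eigenvalues of A, so that positivity is that of a square. *)
Lemma sqrt_op_exists A : selfadjoint M A -> strictly_positive_op M A ->
  exists B, [/\ selfadjoint M B, positive_op M B & B *m B = A].
Proof.
move=> sA pA; have [s chA] := selfadjoint_char_poly_split sA.
have s_ge0 x : x \in undup s -> 0 <= x.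
  rewrite mem_undup -root_prod_XsubC -chA => /(strictly_positive_root_gt0 pA).
  exact: ltW.
have [q qs] :=
  poly_interpolation (fun x => Num.sqrt (Num.sqrt x)) (undup_uniq s).
have sQ := selfadjoint_horner_mx q sA.
exists (horner_mx A (q ^+ 2)); split.
- exact: selfadjoint_horner_mx.
- move=> u; rewrite rmorphXn /= expr2 -mulmxE -mulmxA -sQ.
  exact: innerM_ge0.
apply/eqP; rewrite mulmxE -rmorphM /= -exprD -subr_eq0.
rewrite -{2}(horner_mx_X A) -rmorphB /=.
have /dvdpP[r ->] : \prod_(a <- undup s) ('X - a%:P) %| q ^+ 4 - 'X.
  apply: uniq_roots_dvdp; last by rewrite uniq_rootsE undup_uniq.
  apply/allP => x xs; rewrite rootE !hornerE qs // (exprM _ 2 2).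
  by rewrite !sqr_sqrtr ?sqrtr_ge0 ?s_ge0 // subrr.
by rewrite rmorphM /= (selfadjoint_annihilator sA chA) mulr0.
Qed.

End SelfadjointSquareRoot.

Lemma sqrt_opP (R : realType) n (M A : 'M[R]_n.+1) : spd_mx M ->
  selfadjoint M A -> strictly_positive_op M A ->
  sqrt_op M A *m sqrt_op M A = A.
Proof.
move=> hM sA pA; rewrite /sqrt_op.
by case: xgetP => [B _ []//|]; have [B PB] := sqrt_op_exists hM sA pA => /(_ B).
Qed.

(** A square root of an injective operator is injective. *)
Lemma sqrt_op_mulmx_neq0 (R : realType) n (M A : 'M[R]_n.+1)
    (u : 'cV[R]_n.+1) : spd_mx M ->
  selfadjoint M A -> strictly_positive_op M A -> u != 0 ->
  sqrt_op M A *m u != 0.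
Proof.
move=> hM sA pA u0; apply/eqP => Bu0; have := pA u u0.
by rewrite -(sqrt_opP hM sA pA) -mulmxA Bu0 mulmx0 innerM0r ltxx.
Qed.

(** * Determinants of low-rank updates *)

(** Sylvester's identity: with P = (1, -V; U, 1) and Q = (1, V; 0, 1), both PQ
and QP are block lower triangular, and they have the same determinant. *)
Lemma det_add1_mulmxC (R : comNzRingType) m n (U : 'M[R]_(n, m))
    (V : 'M[R]_(m, n)) :
  \det (1%:M + U *m V) = \det (1%:M + V *m U).
Proof.
pose P := block_mx 1%:M (- V) U 1%:M; pose Q := block_mx 1%:M V 0 1%:M.
have PQ : P *m Q = block_mx 1%:M 0 U (1%:M + U *m V).
  rewrite mulmx_block !mulmx1 !mulmx0 !mul1mx ?mulmx1 !addr0 subrr.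
  by rewrite [1%:M + _]addrC.
have QP : Q *m P = block_mx (1%:M + V *m U) 0 U 1%:M.
  by rewrite mulmx_block !mulmx1 !mul0mx !mul1mx !add0r addNr.
have := congr1 determinant PQ; rewrite det_mulmx mulrC -det_mulmx QP.
by rewrite !det_lblock !det1 mul1r mulr1.
Qed.

Lemma det_rank1_update (R : comUnitRingType) n (K : 'M[R]_n) (u : 'cV[R]_n)
    (w : 'rV[R]_n) : K \in unitmx ->
  \det (K + u *m w) = \det K * (1 + (w *m invmx K *m u) 0 0).
Proof.
move=> uK; have -> : K + u *m w = K *m (1%:M + invmx K *m u *m w).
  by rewrite mulmxDr mulmx1 -mulmxA mulKVmx.
by rewrite det_mulmx det_add1_mulmxC det_mx11 mxE mxE eqxx mulmxA.
Qed.

(** * The log-determinant of the information operator *)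

Section InformationOperator.
Variables (R : realType) (n : nat) (I : finType) (M : 'M[R]_n).
Variable g : I -> 'cV[R]_n.
Implicit Types (S T : {set I}) (u v : 'cV[R]_n).

(** The operator K(S) = I + H~(S), for arbitrary vectors g i in place of the
f~_i. *)
Definition info_op S : 'M[R]_n := 1%:M + \sum_(i in S) tensor M (g i) (g i).

(** The relative increase of the determinant when i is added to S; see
[det_info_opU1]. *)
Definition info_gain S i : R := innerM M (g i) (invmx (info_op S) *m g i).

Hypothesis hM : spd_mx M.

Lemma innerM_info_op S u v : innerM M u (info_op S *m v) =
  innerM M u v + \sum_(i in S) innerM M (g i) u * innerM M (g i) v.
Proof.
rewrite mulmxDl mul1mx innerMDr mulmx_suml innerM_sumr; congr (_ + _).
apply: eq_bigr => i _.
by rewrite tensorP innerMZr mulrC (innerMC hM u).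
Qed.

Lemma info_op_selfadjoint S : selfadjoint M (info_op S).
Proof.
move=> u v; rewrite innerMC // !innerM_info_op innerMC //.
by congr (_ + _); apply: eq_bigr => i _; rewrite mulrC.
Qed.

Lemma innerM_info_op_mono S T u : S \subset T ->
  innerM M u (info_op S *m u) <= innerM M u (info_op T *m u).
Proof.
move=> /finset.setIidPr ST; rewrite !innerM_info_op lerD2l.
rewrite [leRHS](big_setID S) /= ST lerDl.
by apply: sumr_ge0 => i _; rewrite -expr2 sqr_ge0.
Qed.

Lemma innerM_info_op_ge S u : innerM M u u <= innerM M u (info_op S *m u).
Proof.
rewrite innerM_info_op lerDl.
by apply: sumr_ge0 => i _; rewrite -expr2 sqr_ge0.
Qed.

Lemma info_op_unit S : info_op S \in unitmx.
Proof.
rewrite -unitmx_tr -row_free_unit -kermx_eq0.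
apply/rowV0P => w /sub_kermxP /(congr1 trmx).
rewrite trmx_mul trmxK trmx0 => Kw0; apply: trmx_inj; rewrite trmx0.
apply: (innerM_eq0 hM); apply/le_anti.
by rewrite innerM_ge0 // andbT -(innerM0r M w^T) -Kw0 innerM_info_op_ge.
Qed.

(** As K(S) x = g i, the gain is the quadratic form of K(S) itself at x, which
the bound K(S) >= I controls from below. *)
Lemma info_gainE S i (x := invmx (info_op S) *m g i) :
  info_gain S i = innerM M x (info_op S *m x).
Proof. by rewrite -info_op_selfadjoint mulKVmx ?info_op_unit. Qed.

Lemma info_gain_ge0 S i : 0 <= info_gain S i.
Proof.
by rewrite info_gainE (le_trans _ (innerM_info_op_ge _ _)) ?innerM_ge0.
Qed.

Lemma info_gain_gt0 S i : g i != 0 -> 0 < info_gain S i.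
Proof.
move=> gi0; rewrite info_gainE.
apply: lt_le_trans (innerM_info_op_ge _ _); apply: innerM_gt0 => //.
apply: contra_neq gi0 => x0.
by rewrite -[g i](mulKVmx (info_op_unit S)) x0 mulmx0.
Qed.

(** Let K(T) x = K(S) y = g i.  Then
0 <= <y - x, K(S) (y - x)> = <g i, y> - 2 <g i, x> + <x, K(S) x>, and
<x, K(S) x> <= <x, K(T) x> = <g i, x>. *)
Lemma info_gain_anti S T i : S \subset T -> info_gain T i <= info_gain S i.
Proof.
move=> ST; rewrite /info_gain.
set x := invmx (info_op T) *m g i; set y := invmx (info_op S) *m g i.
have Sy : info_op S *m y = g i by rewrite mulKVmx ?info_op_unit.
have Tx : info_op T *m x = g i by rewrite mulKVmx ?info_op_unit.
have := le_trans (innerM_ge0 hM (y - x)) (innerM_info_op_ge S _).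
have := innerM_info_op_mono x ST; rewrite Tx.
rewrite mulmxBr Sy !innerMBl !innerMBr.
rewrite -[innerM M y (_ *m _)]info_op_selfadjoint Sy.
rewrite (innerMC hM y) (innerMC hM x (g i)); lra.
Qed.

Lemma det_info_opU1 S i : i \notin S ->
  \det (info_op (i |: S)) = \det (info_op S) * (1 + info_gain S i).
Proof.
move=> iS; rewrite {1}/info_op big_setU1 //= addrCA addrC.
rewrite /tensor -mulmxA det_rank1_update ?info_op_unit //.
by rewrite /info_gain /innerM !mulmxA.
Qed.

Lemma det_info_op0 : \det (info_op finset.set0) = 1.
Proof. by rewrite /info_op big_set0 addr0 det1. Qed.

Lemma det_info_op_gt0 S : 0 < \det (info_op S).
Proof.
have [k] := ubnP #|S|; elim: k S => // k IHk S.
have [->|[i iS]] := set_0Vmem S; first by rewrite det_info_op0.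
rewrite (cardsD1 i) iS /= add1n => /IHk ltS.
rewrite -(finset.setD1K iS) det_info_opU1 ?finset.setD11 //.
by rewrite mulr_gt0 // ltr_wpDr ?info_gain_ge0.
Qed.

Lemma det_info_op_mono S T : S \subset T ->
  \det (info_op S) <= \det (info_op T).
Proof.
have [k] := ubnP #|T|; elim: k T => // k IHk T ltT.
rewrite subEproper => /predU1P[->//|/properP[ST [i iT iS]]].
move: ltT; rewrite (cardsD1 i) iT /= add1n => /IHk leS.
rewrite -(finset.setD1K iT) det_info_opU1 ?finset.setD11 //.
apply: le_trans (leS _) _; first by rewrite subsetD1 ST iS.
by rewrite ler_peMr ?lerDl ?info_gain_ge0 // ltW ?det_info_op_gt0.
Qed.

Lemma ln_det_info_op_lt S T : (forall i, g i != 0) -> S \proper T ->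
  ln (\det (info_op S)) < ln (\det (info_op T)).
Proof.
move=> g0 /properP[ST [i iT iS]].
rewrite ltr_ln ?posrE ?det_info_op_gt0 // -(finset.setD1K iT).
rewrite det_info_opU1 ?finset.setD11 //.
have /det_info_op_mono leS : S \subset T :\ i by rewrite subsetD1 ST iS.
apply: le_lt_trans leS _.
by rewrite ltr_pMr ?det_info_op_gt0 // ltrDl info_gain_gt0.
Qed.

Lemma ln_det_info_opU1 S i : i \notin S ->
  ln (\det (info_op (i |: S))) - ln (\det (info_op S)) =
  ln (1 + info_gain S i).
Proof.
move=> iS; rewrite det_info_opU1 // lnM ?posrE ?det_info_op_gt0 //.
  by rewrite addrC addKr.
by rewrite ltr_wpDr ?info_gain_ge0.
Qed.

Lemma ln_det_info_op_submodular S T i : S \subset T ->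
  i \notin T ->
  ln (\det (info_op (i |: T))) - ln (\det (info_op T)) <=
  ln (\det (info_op (i |: S))) - ln (\det (info_op S)).
Proof.
move=> ST iT; have iS : i \notin S.
  by apply: contra iT; exact: (fintype.subsetP ST).
rewrite !ln_det_info_opU1 // ler_ln ?posrE ?ltr_wpDr ?info_gain_ge0 //.
by rewrite lerD2l info_gain_anti.
Qed.

End InformationOperator.

Theorem theorem3p1 (R : realType) (n ns : nat) (hn : (0 < n)%N)
    (hns : (0 < ns)%N) (M : 'M[R]_n) (hM : spd_mx M) (F : 'M[R]_(ns, n))
    (sigma : 'I_ns -> R) (hsigma : forall i : 'I_ns, 0 < sigma i)
    (Gpr : 'M[R]_n) (hGpr_sa : selfadjoint M Gpr)
    (hGpr_pos : strictly_positive_op M Gpr)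
    (hf : forall i : 'I_ns, fvec M F sigma i != 0) :
  [/\ Phi_eig M F sigma Gpr finset.set0 = 0,
      (forall A B : {set 'I_ns}, A \proper B ->
         Phi_eig M F sigma Gpr A < Phi_eig M F sigma Gpr B)
    & (forall (A B : {set 'I_ns}) (v : 'I_ns), A \subset B -> v \notin B ->
         Phi_eig M F sigma Gpr (A :|: [set v]) - Phi_eig M F sigma Gpr A >=
         Phi_eig M F sigma Gpr (B :|: [set v]) - Phi_eig M F sigma Gpr B)].
Proof.
have PhiE S : Phi_eig M F sigma Gpr S =
  ln (\det (info_op M (ftilde M F sigma Gpr) S)) by [].
(* Square matrices have a ring structure only in positive size. *)
case: n hn => // n _ in M hM F Gpr hGpr_sa hGpr_pos hf PhiE *.
split=> [|A B AB|A B v AB vB].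
- by rewrite PhiE det_info_op0 ln1.
- rewrite !PhiE ln_det_info_op_lt // => i; exact: sqrt_op_mulmx_neq0.
- by rewrite !PhiE ![_ :|: [set v]]finset.setUC ln_det_info_op_submodular.
Qed.
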